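(* Let $\Omega$ be a connected $k$-orbigraph with adjacency matrix $A$. Then $\Omega$ is good if and only if $\Omega$ satisfies the balanced cycle condition: for every directed cycle $v_1, v_2, \dots, v_l, v_1$ in $\Omega$, the product of the edge weights along it equals the product of the edge weights along the reverse cycle $v_1, v_l, v_{l-1}, \dots, v_2, v_1$, i.e. $A_{v_1v_2}A_{v_2v_3}\cdots A_{v_lv_1} = A_{v_1v_l}A_{v_lv_{l-1}}\cdots A_{v_2v_1}$.
   Context: A $k$-orbigraph is a finite weighted directed graph $\Omega$ (loops allowed) on vertices $v_1,\dots,v_n$ whose adjacency matrix $A$ ($A_{ij}$ = weight of the directed edge $(v_i,v_j)$, $0$ if absent) satisfies: $A_{ij}\in\mathbb{Z}_{\ge 0}$; $\sum_j A_{ij}=k$ for every $i$; and $A_{ij}>0$ iff $A_{ji}>0$. It is connected if its underlying graph is connected. An undirected edge $\{u,v\}$ of weight $w$ is identified with the pair of directed edges $(u,v)$, $(v,u)$ of weight $w$; in particular a simple $k$-regular graph is regarded as a weighted directed graph with all weights $1$. For a weighted (possibly directed) graph $\Gamma$ with weight function $w$, a partition $\mathcal{P}=\{V_1,\dots,V_m\}$ of its vertices is equitable if for every $i,j$ the quantity $\sum_{v\in V_j} w(u,v)$ is the same for all $u\in V_i$; the quotient graph $\Gamma/\mathcal{P}$ is the weighted directed graph on $m$ vertices with adjacency matrix entries $\sum_{v\in V_j} w(u,v)$, $u\in V_i$. A $k$-orbigraph is good if it equals (up to isomorphism) $\Gamma/\mathcal{P}$ for some finite $k$-regular graph $\Gamma$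 and some equitable partition $\mathcal{P}$ of $\Gamma$; otherwise it is bad. *)

(* Defs.v *)
From mathcomp Require Import all_boot all_algebra.

Set Implicit Arguments.
Unset Strict Implicit.
Unset Printing Implicit Defensive.

(* A weighted directed graph on [V] is its weight function [w : V -> V -> nat];
   weight 0 means that the edge is absent. *)
Definition wdigraph_iso (V W : finType) (w : V -> V -> nat) (w' : W -> W -> nat)
    : Prop :=
  exists2 f : V -> W, bijective f & forall x y, w' (f x) (f y) = w x y.

Definition equitable (V : finType) (w : V -> V -> nat) (P : {set {set V}})
    : Prop :=
  partition P [set: V] /\
  forall B C, B \in P -> C \in P ->
    forall u u', u \in B -> u' \in B ->
      \sum_(v in C) w u v = \sum_(v in C) w u' v.

(* The vertices of the quotient are the blocks of [P].  The vertex [u] picked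
   in [B] does not matter when [P] is equitable, and the [else] branch is not
   reached then, since blocks of a partition are nonempty. *)
Definition quotient_weight (V : finType) (w : V -> V -> nat)
    (P : {set {set V}}) (B C : {D : {set V} | D \in P}) : nat :=
  if [pick u in val B] is Some u then \sum_(v in val C) w u v else 0.
Arguments quotient_weight {V} w P B C.

Definition regular_graph (k : nat) (V : finType) (e : rel V) : Prop :=
  [/\ symmetric e, irreflexive e & forall x, #|[set y | e x y]| = k].

Definition graph_weight (V : finType) (e : rel V) (x y : V) : nat :=
  if e x y then 1 else 0.

Definition orbigraph (k n : nat) (A : 'M[nat]_n) : Prop :=
  (forall i, \sum_j A i j = k) /\ (forall i j, 0 < A i j <-> 0 < A j i).

Definition connected_wdigraph (n : nat) (A : 'M[nat]_n) : Prop :=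
  forall i j, connect [rel x y | (0 < A x y) || (0 < A y x)] i j.

Definition good_orbigraph (k n : nat) (A : 'M[nat]_n) : Prop :=
  exists (V : finType) (e : rel V) (P : {set {set V}}),
    [/\ regular_graph k e,
        equitable (graph_weight e) P
      & wdigraph_iso (fun i j => A i j)
          (quotient_weight (graph_weight e) P)].

(* For [s = [:: v_1; ...; v_l]] this is A_{v_1 v_2} ... A_{v_{l-1} v_l} A_{v_l v_1}. *)
Definition cycle_weight (n : nat) (A : 'M[nat]_n) (s : seq 'I_n) : nat :=
  \prod_(p <- zip s (rot 1 s)) A p.1 p.2.

(* Directed cycles have pairwise distinct vertices; loops ([s = [::]]) and
   2-cycles are included. *)
Definition balanced_cycle_condition (n : nat) (A : 'M[nat]_n) : Prop :=
  forall (v : 'I_n) (s : seq 'I_n),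
    cycle [rel x y | 0 < A x y] (v :: s) -> uniq (v :: s) ->
    cycle_weight A (v :: s) = cycle_weight A (v :: rev s).

(* Main.v *)
(** Both conditions are equivalent to the existence of sizes [m i > 0] with
    [m i * A i j = m j * A j i].  Counting the edges between two blocks of an
    equitable partition shows that the block sizes of a good orbigraph have this
    property, and multiplying these relations along a cycle gives the balanced
    cycle condition.  Conversely, balance passes from simple cycles to all closed
    walks (cut at a repeated vertex), so the ratio of the forward to the backward
    weight of a walk from a root to [i] depends on [i] only; clearing
    denominators gives [m].  After scaling, [m i >= A j i] for all [j], and a
    simple graph is built explicitly: [x] in block [i] and [y] in block [j] are
    related when [x = t %% m i] and [y = t %/ A j i] for some
    [t < m i * A i j = m j * A j i].  This relation has the right number of
    related vertices on either side, and its bipartite double is a simple graph. *)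
Require Import Defs.
From mathcomp Require Import all_boot all_algebra.
From mathcomp Require Import zify.

Set Implicit Arguments.
Unset Strict Implicit.
Unset Printing Implicit Defensive.

(** * Weights of walks and of closed walks *)

Section Walks.
Variable T : eqType.
Implicit Types (w : T -> T -> nat) (x : T) (s : seq T).

Fixpoint walk_weight w x s : nat :=
  if s is y :: s' then w x y * walk_weight w y s' else 1.

Lemma walk_weight_cat w x s1 s2 :
  walk_weight w x (s1 ++ s2) = walk_weight w x s1 * walk_weight w (last x s1) s2.
Proof. by elim: s1 x => [|y s1 IH] x /=; rewrite ?mul1n // IH mulnA. Qed.

Lemma walk_weight_rev w x s :
  walk_weight w (last x s) (rev (belast x s)) = walk_weight (fun a b => w b a) x s.
Proof.
elim: s x => [|y s IH] x //=.
rewrite rev_cons -cats1 walk_weight_cat IH /= muln1 mulnC; congr (w _ x * _).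
by case: s {IH} => [|z s] //=; rewrite rev_cons last_rcons.
Qed.

Lemma walk_weight_gt0 w x s :
  path (fun a b => 0 < w a b) x s -> 0 < walk_weight w x s.
Proof.
by elim: s x => [|y s IH] x //= /andP[wxy /IH ws]; rewrite muln_gt0 wxy.
Qed.

Lemma walk_weight_zip w x s :
  \prod_(p <- zip (belast x s) s) w p.1 p.2 = walk_weight w x s.
Proof.
by elim: s x => [|y s IH] x /=; rewrite ?big_nil // big_cons IH.
Qed.

Lemma not_uniq_closed_subwalk x s : ~~ uniq (x :: s) ->
  exists u v r, [/\ s = u ++ v ++ r, 0 < size v & last (last x u) v = last x u].
Proof.
elim: s x => [|y s IH] x //.
have [xs _|xs] := boolP (x \in y :: s).
  case/splitPr: xs => s1 s2; exists [::], (rcons s1 x), s2.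
  by rewrite cat_rcons size_rcons last_rcons.
rewrite cons_uniq xs => /IH[u [v [r [-> v_gt0 uv]]]].
by exists (y :: u), v, r.
Qed.

(** Strong induction on the length. A repeated vertex splits the walk into a nonempty closed subwalk
    [v] and the closed walk left once [v] is cut out; both are shorter, since the final step to [x]
    lies outside [v]. *)
Lemma closed_walk_balance w :
  (forall x s, path (fun a b => 0 < w a b) x (rcons s x) -> uniq (x :: s) ->
     walk_weight w x (rcons s x) = walk_weight (fun a b => w b a) x (rcons s x)) ->
  forall x s, path (fun a b => 0 < w a b) x s -> last x s = x ->
    walk_weight w x s = walk_weight (fun a b => w b a) x s.
Proof.
move=> bal x s; have [N] := ubnP (size s); elim: N x s => // N IH x s.
case/lastP: s => [|s z] //; rewrite size_rcons last_rcons => sN ps Ez.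
rewrite {z}Ez in ps *; have [us|] := boolP (uniq (x :: s)); first exact: bal.
move=> /not_uniq_closed_subwalk[u [v [r [Es v_gt0 Ev]]]].
move: ps sN; rewrite {s}Es -!cats1 -!catA !cat_path !size_cat Ev.
case/and3P=> pu pv pr sN.
rewrite !walk_weight_cat Ev mulnCA [RHS]mulnCA; congr (_ * _).
  by apply: IH => //; lia.
rewrite -!walk_weight_cat; apply: IH.
- by rewrite !size_cat /=; lia.
- by rewrite cat_path pu cat_path.
- by rewrite !last_cat.
Qed.

End Walks.

(** * Balance, block sizes and quotients by fibres *)

Section Matrices.
Variables (n : nat) (A : 'M[nat]_n).

Lemma cycle_weightE v s :
  cycle_weight A (v :: s) = walk_weight (fun i j => A i j) v (rcons s v).
Proof. by rewrite /cycle_weight rot1_cons -walk_weight_zip belast_rcons. Qed.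

Lemma cycle_weight_rev v s :
  cycle_weight A (v :: rev s) = walk_weight (fun i j => A j i) v (rcons s v).
Proof.
rewrite cycle_weightE -(walk_weight_rev (fun i j => A i j)).
by rewrite last_rcons belast_rcons rev_cons.
Qed.

Lemma balanced_of_sizes (m : 'I_n -> nat) :
  (forall i, 0 < m i) -> (forall i j, m i * A i j = m j * A j i) ->
  balanced_cycle_condition A.
Proof.
move=> m_gt0 mA v s _ _; rewrite cycle_weight_rev cycle_weightE.
have W x t : m x * walk_weight (fun i j => A i j) x t
           = m (last x t) * walk_weight (fun i j => A j i) x t.
  elim: t x => [|y t IH] x //=.
  by rewrite mulnA mA -mulnA mulnCA IH mulnCA.
have := W v (rcons s v); rewrite last_rcons => /eqP.
by rewrite eqn_pmul2l // => /eqP.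
Qed.

Lemma good_sizes k : good_orbigraph k A ->
  exists2 m : 'I_n -> nat,
    forall i, 0 < m i & forall i j, m i * A i j = m j * A j i.
Proof.
case=> V [e [P [[e_sym _ _] [/and3P[_ _ P0] P_eq] [f _ fA]]]].
have Bgt0 i : 0 < #|val (f i)|.
  rewrite card_gt0; apply: contraNneq P0 => <-; exact: valP.
have mA i j :
    #|val (f i)| * A i j = \sum_(u in val (f i)) \sum_(v in val (f j)) graph_weight e u v.
  rewrite -sum_nat_const; apply: eq_bigr => u fu; rewrite -fA /quotient_weight.
  case: pickP => [u' fu'|/(_ u)]; last by rewrite fu.
  by apply: P_eq fu' fu; apply: valP.
exists (fun i => #|val (f i)|) => // i j; rewrite !mA exchange_big /=.
by do 2!apply: eq_bigr => ? _; rewrite /graph_weight e_sym.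
Qed.

Lemma sizes_of_balanced k : orbigraph k A -> connected_wdigraph A ->
  balanced_cycle_condition A ->
  exists2 m : 'I_n -> nat,
    forall i, 0 < m i & forall i j, m i * A i j = m j * A j i.
Proof.
move=> [_ A_supp] A_conn A_bal.
have supp i j : (0 < A i j) = (0 < A j i) by apply/idP/idP => /A_supp.
have [r _|noI] := pickP 'I_n; last first.
  by exists (fun=> 1) => // i; have := noI i.
pose w i j := A i j; pose e i j := 0 < w i j.
have e_sym i j : e i j = e j i by rewrite /e /w supp.
have closed x s : path e x s -> last x s = x ->
    walk_weight w x s = walk_weight (fun a b => w b a) x s.
  apply: closed_walk_balance => {}x {}s ps us.
  by rewrite -cycle_weightE -cycle_weight_rev; apply: A_bal.
have /fin_all_exists[p pP] j : exists s, path e r s /\ j = last r s.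
  have /connectP[s ps ->] := A_conn r j; exists s; split=> //.
  by apply: sub_path ps => x y /=; rewrite -(supp x y) orbb.
pose a j := walk_weight w r (p j).
pose b j := walk_weight (fun a b => w b a) r (p j).
have b_gt0 j : 0 < b j.
  apply: walk_weight_gt0; have [+ _] := pP j.
  by apply: sub_path => x y; rewrite e_sym.
have a_gt0 j : 0 < a j by apply: walk_weight_gt0; have [] := pP j.
(* The size relation for the ratios [a i / b i], cross-multiplied. *)
have ab i j : a i * A i j * b j = a j * A j i * b i.
  have [Aij|] := posnP (A i j).
    have : ~~ (0 < A j i) by rewrite supp Aij.
    by rewrite -eqn0Ngt Aij => /eqP->; rewrite !muln0.
  have [[]] := (pP i, pP j); rewrite /a /b.
  move: (p i) (p j) => s t ps Ei [pt Ej] Aij; subst i j.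
  (* This closed walk follows [s] from the root, crosses the edge in question and returns along the
     reversal of [t]. *)
  have := closed r (s ++ last r t :: rev (belast r t)).
  rewrite cat_path ps /= /e Aij rev_path (sub_path _ pt) => [|x y]; last by rewrite e_sym.
  have -> : last r (s ++ last r t :: rev (belast r t)) = r.
    by rewrite last_cat /=; case: (t) => //= y t'; rewrite rev_cons last_rcons.
  move=> /(_ isT erefl); rewrite !walk_weight_cat /= !walk_weight_rev => E.
  by rewrite -[LHS]mulnA [LHS]E mulnC; congr (_ * _); apply: mulnC.
(* [D] is a common denominator: the sizes below are [D * a i / b i], written without division. *)
pose D := \prod_j b j.
have Db j : D = b j * \prod_(l | l != j) b l by rewrite /D (bigD1 j).
exists (fun i => a i * \prod_(l | l != i) b l) => [i|i j].
  by rewrite muln_gt0 a_gt0 prodn_gt0.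
apply/eqP; rewrite -(eqn_pmul2l (b_gt0 i)) -(eqn_pmul2l (b_gt0 j)); apply/eqP.
transitivity (D * (a i * A i j * b j)); first by rewrite (Db i); lia.
by rewrite ab (Db j); lia.
Qed.

(** The blocks are the fibres of [p]. Surjectivity makes them nonempty, so distinct indices give
    distinct blocks. *)
Lemma good_of_fibers k (V : finType) (e : rel V) (p : V -> 'I_n) :
  (forall i, \sum_j A i j = k) -> symmetric e -> irreflexive e ->
  (forall i, exists u, p u = i) ->
  (forall u j, #|[set v | e u v & p v == j]| = A (p u) j) ->
  good_orbigraph k A.
Proof.
move=> A_k e_sym e_irr p_surj eA.
have w_sum u j : \sum_(v in [set v | p v == j]) graph_weight e u v = A (p u) j.
  rewrite -eA -sum1_card -big_mkcondr; apply: eq_bigl => v.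
  by rewrite !inE andbC.
pose P := preim_partition p [set: V].
have PP B : reflect (exists i, B = [set v | p v == i]) (B \in P).
  apply: (iffP imsetP) => [[u _ ->]|[i ->]].
    by exists (p u); apply/setP => v; rewrite !inE eq_sym.
  have [u <-] := p_surj i; exists u => //.
  by apply/setP => v; rewrite !inE eq_sym.
exists V, e, P; split.
- split=> // u; rewrite -(A_k (p u)) -sum1_card (partition_big p predT) //=.
  apply: eq_bigr => j _; rewrite -eA -sum1_card.
  by apply: eq_bigl => v; rewrite !inE.
- split; first exact: preim_partitionP.
  move=> B C /PP[i ->] /PP[j ->] u u'; rewrite !w_sum !inE.
  by move=> /eqP-> /eqP->.
- have PF i : [set v | p v == i] \in P by apply/PP; exists i.
  pose f i : {B | B \in P} := exist (fun B : {set V} => B \in P) _ (PF i).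
  have f_inj : injective f.
    move=> i j /(congr1 val) /= /setP; have [u <-] := p_surj i.
    by move=> /(_ u); rewrite !inE eqxx => /esym/eqP.
  exists f => [|i j].
    have /fin_all_exists[g fg] B : exists i, f i = B.
      by have /PP[i Bi] := valP B; exists i; apply: val_inj.
    by exists g => // i; apply: f_inj.
  rewrite /quotient_weight; case: pickP => [u|none].
    by rewrite w_sum inE => /eqP->.
  by have [u pu] := p_surj i; have := none u; rewrite /= inE pu eqxx.
Qed.

End Matrices.

(** * Biregular relations between two finite sets *)

Section Biregular.

(** Edges are numbered consecutively, [b] for each [y], and dealt out to the [M] values of [x] in
    rotation. *)
Definition biregular_rel (M b x y : nat) : bool :=
  [exists r : 'I_b, (y * b + r) %% M == x].

(** At most [M] consecutive integers have distinct residues modulo [M]. *)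
Lemma card_biregular_left M b y : b <= M ->
  #|[set x : 'I_M | biregular_rel M b x y]| = b.
Proof.
move=> bM; have [M0|M_gt0] := posnP M.
  have := max_card [set x : 'I_M | biregular_rel M b x y].
  rewrite card_ord; lia.
pose f (r : 'I_b) := Ordinal (ltn_pmod (y * b + r) M_gt0).
have f_inj : injective f.
  move=> r r' /(congr1 val) /= /eqP.
  rewrite eqn_modDl !modn_small ?(leq_trans (ltn_ord _)) // => /eqP.
  exact: val_inj.
rewrite -[RHS](card_ord b) -(card_imset _ f_inj); apply: eq_card => x.
rewrite inE; apply/existsP/imsetP => [[r /eqP rx]|[r _ ->]]; exists r => //.
exact: val_inj.
Qed.

(** The edges at [x] have the numbers [x + q * M] with [q < a]. These are at least [M >= b] apart,
    so their quotients by [b] are distinct. *)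
Lemma card_biregular_right M M' a b x : M * a = M' * b -> b <= M -> x < M ->
  #|[set y : 'I_M' | biregular_rel M b x y]| = a.
Proof.
move=> E bM xM.
(* [b] can be 0, but only together with [a]; an element of ['I_a] excludes this. *)
have b_gt0 (q : 'I_a) : 0 < b by have := ltn_ord q; nia.
have tE (q : 'I_a) : x + q * M < M' * b by have := ltn_ord q; nia.
have f_lt (q : 'I_a) : (x + q * M) %/ b < M' by rewrite ltn_divLR // b_gt0.
pose f (q : 'I_a) := Ordinal (f_lt q).
have f_mono (q q' : 'I_a) : q < q' -> f q < f q'.
  move=> qq'; rewrite /= leq_divRL ?(b_gt0 q) // mulSn.
  have := leq_trunc_div (x + q * M) b; nia.
have f_inj : injective f.
  move=> q q' fq; apply: val_inj => /=.
  by case: (ltngtP q q') => // /f_mono; rewrite fq ltnn.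
rewrite -[RHS](card_ord a) -(card_imset _ f_inj); apply: eq_card => y.
rewrite inE; apply/existsP/imsetP => [[r /eqP rx]|[q _ ->]].
  have q_lt : (y * b + r) %/ M < a.
    rewrite ltn_divLR; last by lia.
    by have := ltn_ord y; have := ltn_ord r; nia.
  exists (Ordinal q_lt) => //; apply: val_inj => /=.
  by rewrite -rx addnC -divn_eq divnMDl ?divn_small ?addn0 //; have := ltn_ord r; lia.
exists (Ordinal (ltn_pmod (x + q * M) (b_gt0 q))) => /=.
by rewrite -divn_eq addnC modnMDl modn_small.
Qed.

End Biregular.

Lemma good_of_sizes k n (A : 'M[nat]_n) (m : 'I_n -> nat) :
  (forall i, \sum_j A i j = k) ->
  (forall i, 0 < m i) -> (forall i j, m i * A i j = m j * A j i) ->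
  good_orbigraph k A.
Proof.
(* Entries of [A] are at most [k], so the factor [k.+1] yields the bound [AM] that keeps the dealt
   edges distinct. *)
move=> A_k m_gt0 mA; pose M i := k.+1 * m i.
have MA i j : M i * A i j = M j * A j i by rewrite -!mulnA mA.
have AM i j : A j i <= M i.
  have : A j i <= k by rewrite -(A_k j) (bigD1 i) //= leq_addr.
  by have := m_gt0 i; rewrite /M; nia.
pose T : finType := {i : 'I_n & 'I_(M i)}.
pose R (u v : T) :=
  biregular_rel (M (tag u)) (A (tag v) (tag u)) (tagged u) (tagged v).
(* [R] need be neither symmetric nor irreflexive. Edges join only different copies of [T], and [R]
   always takes its first argument from the [false] copy. *)
pose V : finType := (bool * T)%type.
pose e (u v : V) := (u.1 != v.1) && (if u.1 then R v.2 u.2 else R u.2 v.2).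
apply: (@good_of_fibers _ _ _ V e (fun u => tag u.2)) => //.
- by move=> [[] u] [[] v].
- by move=> [[] u].
- move=> i; have Mi : 0 < M i by rewrite /M muln_gt0 m_gt0.
  by exists (false, Tagged (fun i => 'I_(M i)) (Ordinal Mi)).
move=> [s [i x]] j /=.
pose g (y : 'I_(M j)) : V := (~~ s, Tagged (fun i => 'I_(M i)) y).
have g_inj : injective g by move=> y y' [] /eqP; rewrite eq_Tagged => /eqP.
pose B := if s then [set y : 'I_(M j) | biregular_rel (M j) (A i j) y x]
          else [set y : 'I_(M j) | biregular_rel (M i) (A j i) x y].
transitivity #|B|; last first.
  rewrite /B; case: s {g g_inj B}; first exact: card_biregular_left.
  exact: card_biregular_right.
rewrite -(card_imset _ g_inj); apply: eq_card => v; rewrite inE.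
apply/andP/imsetP => [[+ /eqP]|[y yB ->]] /=.
  case: v => s' [j' y] /= + Ej; subst j' => /andP[/= ss' sR].
  exists y; first by rewrite /B; case: (s) sR; rewrite inE.
  by congr (_, _); case: (s) (s') ss' => [] [].
rewrite eqxx; split=> //; rewrite /e /=; move: yB; rewrite /B.
by case: (s); rewrite inE.
Qed.

Theorem theorem4p2 (k n : nat) (A : 'M[nat]_n) :
  orbigraph k A -> connected_wdigraph A ->
  (good_orbigraph k A <-> balanced_cycle_condition A).
Proof.
move=> A_orb A_conn; split=> [/good_sizes[m]|A_bal].
  exact: balanced_of_sizes.
have [m m_gt0 mA] := sizes_of_balanced A_orb A_conn A_bal.
exact: good_of_sizes A_orb.1 m_gt0 mA.
Qed.
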